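(* The map $\varphi_0$ defined by $\varphi_0(x)=x^\perp\cap Q_0$ for every point $x\in Q\setminus Q_0$, and $\varphi_0(\hat l)=\{x^\perp\cap Q_0: x\in\hat l\}$ for every line $\hat l$ of $\hat{\mathcal X}$, is well defined (i.e. $x^\perp\cap Q_0$ is an elliptic ovoid of $Q_0$ and $\varphi_0(\hat l)$ is a rosette based at $l^\infty$) and is a $2$-fold covering from $\hat{\mathcal X}$ to $\mathcal X$.
   Context: Let $q=2^n$, $V=V(6,q)$, and let $Q=Q^-(5,q)$ be the set of singular points of a non-degenerate quadratic form $f$ of Witt index $2$ on $V$, viewed as a generalized quadrangle of order $(q,q^2)$ whose lines are the totally singular lines of $\mathrm{PG}(V)$. Let $\perp$ denote the polarity of $\mathrm{PG}(V)$ defined by the bilinear form associated with $f$. Let $H_0$ be a hyperplane of $\mathrm{PG}(V)$ with $Q_0:=Q\cap H_0\cong Q(4,q)$ a parabolic quadric, and let $n_0:=H_0^\perp$ (the nucleus of $Q_0$, a point not on $Q$). An elliptic ovoid of $Q_0$ is a set $X=S\cap Q_0$ where $S$ is a $3$-dimensional projective subspace of $H_0$ meeting $Q_0$ in an elliptic quadric $Q^-(3,q)$. Two distinct elliptic ovoids meet in one point or in a conic; they are tangent if they meet in exactly one point. A rosette based at a point $p\in Q_0$ is a set of $q$ elliptic ovoids pairwise meeting exactly in $\{p\}$. The geometry $\mathcal X$ has the elliptic ovoids of $Q_0$ as points, the rosettes as lines, incidence being membership. The affine geometry $\hat{\mathcal X}$ has as points the points of $Q\setminus Q_0$ and as lines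 the sets $\hat l=l\setminus\{l^\infty\}$, where $l$ ranges over the lines of $Q$ not contained in $Q_0$ and $l^\infty:=l\cap Q_0$; incidence is inclusion. A morphism of rank-2 geometries (mapping points to points, lines to lines, preserving incidence) is a covering if for every point $x$ and line $L$ it induces bijections from the points of $L$ onto the points of the image of $L$ and from the lines through $x$ onto the lines through the image of $x$; it is $2$-fold if all fibres have size $2$. *)

(* Defs.v *)
From HB Require Import structures.
From mathcomp Require Import all_boot all_order all_algebra all_fingroup all_field.
Set Implicit Arguments. Unset Strict Implicit. Unset Printing Implicit Defensive.
Import GRing.Theory.
Local Open Scope ring_scope.

Section QuadricGeometry.
Variable F : finFieldType.

(* V = F^6 as row vectors; a quadratic form is v |-> v A v^T for a matrix A
   (every quadratic form arises this way); its associated bilinear form is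
   b(u,v) = f(u+v) - f(u) - f(v) = u (A + A^T) v^T. *)
Definition qf (A : 'M[F]_6) (v : 'rV[F]_6) : F := (v *m A *m v^T) ord0 ord0.
Definition bf (A : 'M[F]_6) (u v : 'rV[F]_6) : F := (u *m (A + A^T) *m v^T) ord0 ord0.

(* Subspaces of V are represented by (row spaces of) 6x6 matrices.
   A projective point is a 1-dimensional subspace, in canonical form <<p>>. *)
Definition is_point (p : 'M[F]_6) : bool := (\rank p == 1%N) && (<<p>>%MS == p).

Definition pts_of (W : 'M[F]_6) : {set 'M[F]_6} :=
  [set p : 'M[F]_6 | is_point p && (p <= W)%MS].

Definition tot_sing (A U : 'M[F]_6) : bool :=
  [forall v : 'rV[F]_6, (v <= U)%MS ==> (qf A v == 0)].

Definition quadric (A : 'M[F]_6) : {set 'M[F]_6} :=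
  [set p : 'M[F]_6 | is_point p && tot_sing A p].

Definition nonsingular_on (A W : 'M[F]_6) : bool :=
  [forall v : 'rV[F]_6,
     [&& (v <= W)%MS, qf A v == 0 &
         [forall w : 'rV[F]_6, (w <= W)%MS ==> (bf A v w == 0)]] ==> (v == 0)].

Definition witt_index_on (A W : 'M[F]_6) (k : nat) : bool :=
  [exists U : 'M[F]_6, [&& (U <= W)%MS, \rank U == k & tot_sing A U]] &&
  [forall U : 'M[F]_6, ((U <= W)%MS && tot_sing A U) ==> (\rank U <= k)%N].

Definition perp_pts (A x : 'M[F]_6) : {set 'M[F]_6} :=
  [set p : 'M[F]_6 | is_point p &&
     [forall v : 'rV[F]_6, forall w : 'rV[F]_6,
        ((v <= x)%MS && (w <= p)%MS) ==> (bf A v w == 0)]].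

Definition Q0 (A H0 : 'M[F]_6) : {set 'M[F]_6} := quadric A :&: pts_of H0.

(* Elliptic ovoid of Q_0: S cap Q_0 with S a projective 3-space (vector
   dimension 4) of H_0 on which f induces an elliptic quadric Q^-(3,q)
   (non-degenerate, Witt index 1). *)
Definition ell_ovoid (A H0 : 'M[F]_6) (X : {set 'M[F]_6}) : bool :=
  [exists S : 'M[F]_6,
     [&& (S <= H0)%MS, \rank S == 4%N, nonsingular_on A S, witt_index_on A S 1
       & X == Q0 A H0 :&: pts_of S]].

Definition ovoids (A H0 : 'M[F]_6) : {set {set 'M[F]_6}} :=
  [set X : {set 'M[F]_6} | ell_ovoid A H0 X].

Definition rosette_at (A H0 : 'M[F]_6) (p : 'M[F]_6) (R : {set {set 'M[F]_6}}) : bool :=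
  [&& p \in Q0 A H0, #|R| == #|F|, R \subset ovoids A H0 &
      [forall X in R, forall Y in R, (X != Y) ==> (X :&: Y == [set p])]].

Definition rosettes (A H0 : 'M[F]_6) : {set {set {set 'M[F]_6}}} :=
  [set R : {set {set 'M[F]_6}} | [exists p : 'M[F]_6, rosette_at A H0 p R]].

Definition affine_Q_lines (A H0 : 'M[F]_6) : {set 'M[F]_6} :=
  [set L : 'M[F]_6 | [&& \rank L == 2%N, tot_sing A L & ~~ (L <= H0)%MS]].

(* hat l = l \ {l^infty}, the points of l not in H_0. *)
Definition hat_line (H0 L : 'M[F]_6) : {set 'M[F]_6} := pts_of L :\: pts_of H0.

Definition hatX_points (A H0 : 'M[F]_6) : {set 'M[F]_6} := quadric A :\: Q0 A H0.
Definition hatX_lines (A H0 : 'M[F]_6) : {set {set 'M[F]_6}} :=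
  [set hat_line H0 L | L in affine_Q_lines A H0].

Definition phi0_pt (A H0 : 'M[F]_6) (x : 'M[F]_6) : {set 'M[F]_6} :=
  perp_pts A x :&: Q0 A H0.
Definition phi0_line (A H0 : 'M[F]_6) (lh : {set 'M[F]_6}) : {set {set 'M[F]_6}} :=
  [set phi0_pt A H0 x | x in lh].

End QuadricGeometry.

(* Rank-2 geometries whose lines are sets of points, incidence = membership.
   A morphism (f on points, g on lines) is a covering if it preserves points,
   lines and incidence, and induces bijections from the points of each line l
   onto the points of g l, and from the lines through each point x onto the
   lines through f x. *)
Definition geom_covering (P P' : finType) (pts : {set P}) (lns : {set {set P}})
    (pts' : {set P'}) (lns' : {set {set P'}}) (f : P -> P') (g : {set P} -> {set P'}) : Prop :=
  [/\ {in pts, forall x, f x \in pts'},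
      {in lns, forall l, g l \in lns'},
      (forall x l, x \in pts -> l \in lns -> x \in l -> f x \in g l),
      (forall l, l \in lns ->
         {in [set x in pts | x \in l] &, injective f} /\
         f @: [set x in pts | x \in l] = [set y in pts' | y \in g l])
    & (forall x, x \in pts ->
         {in [set l in lns | x \in l] &, injective g} /\
         g @: [set l in lns | x \in l] = [set m in lns' | f x \in m])].

Definition two_fold (P P' : finType) (pts : {set P}) (lns : {set {set P}})
    (pts' : {set P'}) (lns' : {set {set P'}}) (f : P -> P') (g : {set P} -> {set P'}) : Prop :=
  (forall y, y \in pts' -> #|[set x in pts | f x == y]| = 2%N) /\
  (forall m, m \in lns' -> #|[set l in lns | g l == m]| = 2%N).

(* Main.v *)
(** Write H_0 = N^perp. For a singular point x off H_0 the 4-space <x, N>^perp is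
    non-degenerate and x^perp meets Q_0 in its singular points, which span it; so
    x^perp meets Q_0 in the same set as y^perp exactly when y lies on the line <x, N>,
    whose singular points are x and its image under the transvection with centre N.
    Every elliptic ovoid arises in this way: if the plane orthogonal to its 4-space S
    were anisotropic, it would be similar to the anisotropic part of S, and the
    two planes together with a singular vector of S would give a totally singular 3-space.
    If the ovoids of x and y are tangent at p, then p spans the radical of
    <x, y, N>^perp, hence lies in <x, y, N>, and y can be moved along <y, N> onto
    the line <x, p>. So a rosette through the ovoid of x with base p consists of the
    ovoids of the q affine points of <x, p>. *)
Require Import Defs.
From HB Require Import structures.
From mathcomp Require Import all_boot all_order all_algebra all_fingroup all_field.
From mathcomp Require Import ring zify.
Set Implicit Arguments. Unset Strict Implicit. Unset Printing Implicit Defensive.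
Import GRing.Theory.
Local Open Scope ring_scope.

(** * Quadratic forms, orthogonal spaces and totally singular subspaces *)

Section QuadraticForm.
Variables (F : finFieldType) (A : 'M[F]_6).
Implicit Types (u v w y : 'rV[F]_6) (a c : F).

Lemma mulmx_tr_form (B : 'M[F]_6) u v :
  (u *m B *m v^T) ord0 ord0 = (v *m B^T *m u^T) ord0 ord0.
Proof.
have -> : v *m B^T *m u^T = (u *m B *m v^T)^T by rewrite !trmx_mul trmxK mulmxA.
by rewrite [RHS]mxE.
Qed.

Lemma bf_sym u v : bf A u v = bf A v u.
Proof. by rewrite /bf mulmx_tr_form linearD /= trmxK addrC. Qed.

Lemma bfDl u v w : bf A (u + v) w = bf A u w + bf A v w.
Proof. by rewrite /bf !mulmxDl mxE. Qed.

Lemma bfZl a u v : bf A (a *: u) v = a * bf A u v.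
Proof. by rewrite /bf -!scalemxAl mxE. Qed.

Lemma bfDr u v w : bf A w (u + v) = bf A w u + bf A w v.
Proof. by rewrite bf_sym bfDl !(bf_sym w). Qed.

Lemma bfZr a u v : bf A v (a *: u) = a * bf A v u.
Proof. by rewrite bf_sym bfZl bf_sym. Qed.

Lemma bf0l v : bf A 0 v = 0.
Proof. by rewrite -(scale0r 0) bfZl mul0r. Qed.

Lemma bf0r v : bf A v 0 = 0.
Proof. by rewrite bf_sym bf0l. Qed.

Lemma bf_lin a u c v w : bf A (a *: u + c *: v) w = a * bf A u w + c * bf A v w.
Proof. by rewrite bfDl !bfZl. Qed.

Lemma qfZ a v : qf A (a *: v) = a ^+ 2 * qf A v.
Proof. by rewrite /qf linearZ /= -scalemxAr -!scalemxAl !mxE mulrA expr2. Qed.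

Lemma qfD u v : qf A (u + v) = qf A u + qf A v + bf A u v.
Proof.
have addE (B C : 'M[F]_1) : (B + C) ord0 ord0 = B ord0 ord0 + C ord0 ord0 by rewrite mxE.
rewrite /qf /bf mulmxDr linearD /= !mulmxDl !mulmxDr !addE.
by rewrite (mulmx_tr_form A^T) trmxK; ring.
Qed.

Lemma qf0 : qf A 0 = 0.
Proof. by rewrite -(scale0r 0) qfZ expr0n mul0r. Qed.

Lemma qf_lin a u c v :
  qf A (a *: u + c *: v) = a ^+ 2 * qf A u + c ^+ 2 * qf A v + a * c * bf A u v.
Proof. by rewrite qfD !qfZ bfZl bfZr mulrA. Qed.

Lemma bf_self v : bf A v v = qf A v + qf A v.
Proof.
have E := qfD v v; have : v + v = (1 + 1) *: v by rewrite scalerDl scale1r.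
move=> vv; rewrite vv qfZ in E.
have -> : bf A v v = (1 + 1) ^+ 2 * qf A v - (qf A v + qf A v) by rewrite E; ring.
by ring.
Qed.

(** The row count [m] stays free so that a vector can stand for its own span. *)
Definition perp m (W : 'M[F]_(m, 6)) : 'M[F]_6 := kermx ((A + A^T) *m W^T).

Lemma perpP m (W : 'M[F]_(m, 6)) v :
  reflect (forall w, (w <= W)%MS -> bf A v w = 0) (v <= perp W)%MS.
Proof.
apply: (iffP sub_kermxP) => [vW w /submxP[D ->]|vW].
  by rewrite /bf trmx_mul mulmxA -(mulmxA v) vW mul0mx mxE.
apply/rowP=> i; rewrite [RHS]mxE -(vW (row i W) (row_sub _ _)) /bf.
by rewrite mulmxA !mxE; apply: eq_bigr => j _; rewrite !mxE.
Qed.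

Lemma perp_bf m (W : 'M[F]_(m, 6)) v w :
  (v <= perp W)%MS -> (w <= W)%MS -> bf A v w = 0.
Proof. by move=> /perpP vW /vW. Qed.

Lemma ex_not_orthogonal m (W : 'M[F]_(m, 6)) v :
  ~~ (v <= perp W)%MS -> exists2 w : 'rV[F]_6, (w <= W)%MS & bf A v w != 0.
Proof.
move=> vW; have [E|/forallPn[w]] := boolP [forall w : 'rV_6, (w <= W)%MS ==> (bf A v w == 0)].
  by case/perpP: vW => w wW; apply/eqP/(implyP (forallP E w)).
by rewrite negb_imply => /andP[]; exists w.
Qed.

Lemma perp_sub m1 m2 (U : 'M[F]_(m1, 6)) (W : 'M[F]_(m2, 6)) :
  (U <= W)%MS -> (perp W <= perp U)%MS.
Proof.
by move=> UW; apply/rV_subP=> v /perpP vW; apply/perpP=> w /submx_trans/(_ UW)/vW.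
Qed.

Lemma perp_rVP v w : (v <= perp w)%MS = (bf A v w == 0).
Proof.
apply/perpP/eqP => [|vw0 _ /sub_rVP[a ->]]; first by apply.
by rewrite bfZr vw0 mulr0.
Qed.

Lemma perp_addsP m1 m2 (U : 'M[F]_(m1, 6)) (W : 'M[F]_(m2, 6)) v :
  (v <= perp (U + W)%MS)%MS = (v <= perp U)%MS && (v <= perp W)%MS.
Proof.
apply/perpP/andP => [vUW|[/perpP vU /perpP vW] _ /sub_addsmxP[[a c] ->] /=].
  by split; apply/perpP=> w wU; apply: vUW; rewrite (submx_trans wU) ?addsmxSl ?addsmxSr.
by rewrite bfDr vU ?vW ?addr0 ?submxMl.
Qed.

Lemma mem_adds_rV u v w :
  reflect (exists a c, w = a *: u + c *: v) (w <= (u + v)%MS)%MS.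
Proof.
apply: (iffP sub_addsmxP) => [[[x y] ->]|[a [c ->]]] /=.
  by exists (x ord0 ord0), (y ord0 ord0); rewrite {1}[x]mx11_scalar {1}[y]mx11_scalar !mul_scalar_mx.
by exists (a%:M, c%:M); rewrite /= !mul_scalar_mx.
Qed.

Lemma rank_add_rV u v : u != 0 -> ~~ (v <= u)%MS -> \rank (u + v)%MS = 2%N.
Proof.
move=> u0 vu; apply/eqP; rewrite eqn_leq; apply/andP; split.
  by rewrite (leq_trans (mxrank_adds_leqif _ _)) // !rank_rV; case: (u != 0); case: (v != 0).
suff : (u < u + v)%MS by move/rank_ltmx; rewrite rank_rV u0.
by rewrite ltmxE addsmxSl addsmx_sub submx_refl.
Qed.

Lemma rank_perp_ge m (W : 'M[F]_(m, 6)) : (6 - \rank W <= \rank (perp W))%N.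
Proof.
by rewrite mxrank_ker leq_sub2l // -(mxrank_tr W) mxrankM_maxr.
Qed.

Lemma ex_not_sub (W : 'M[F]_6) u : (1 < \rank W)%N -> exists2 v : 'rV[F]_6, (v <= W)%MS & ~~ (v <= u)%MS.
Proof.
move=> rW; have /row_subPn[i Wi] : ~~ (W <= u)%MS.
  apply: contraL rW => Wu; rewrite -leqNgt (leq_trans (mxrankS Wu)) // rank_rV.
  by case: eqP.
by exists (row i W); rewrite ?row_sub.
Qed.

Lemma tot_singP (U : 'M[F]_6) :
  reflect (forall v, (v <= U)%MS -> qf A v = 0) (tot_sing A U).
Proof.
by apply: (iffP forallP) => U0 v; [move=> vU; apply/eqP/(implyP (U0 v))|apply/implyP=> /U0 ->].
Qed.

Lemma tot_sing_bf (U : 'M[F]_6) u v : tot_sing A U -> (u <= U)%MS -> (v <= U)%MS -> bf A u v = 0.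
Proof.
move=> /tot_singP U0 uU vU; have := U0 (u + v); rewrite addmx_sub // qfD !U0 // !add0r.
by apply.
Qed.

Lemma tot_sing_rV v : tot_sing A <<v>>%MS = (qf A v == 0).
Proof.
apply/tot_singP/eqP => [|v0 w]; first by apply; rewrite genmxE.
by rewrite genmxE => /sub_rVP[a ->]; rewrite qfZ v0 mulr0.
Qed.

Lemma tot_sing_adds m (U : 'M[F]_6) (W : 'M[F]_(m, 6)) :
  tot_sing A U -> (forall w, (w <= W)%MS -> qf A w = 0) ->
  (forall u w, (u <= U)%MS -> (w <= W)%MS -> bf A u w = 0) -> tot_sing A (U + W)%MS.
Proof.
move=> /tot_singP U0 W0 UW; apply/tot_singP=> _ /sub_addsmxP[[x y] ->] /=.
by rewrite qfD U0 ?W0 ?UW ?addr0 ?submxMl.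
Qed.

Lemma tot_sing_adds_rV u v : qf A u = 0 -> qf A v = 0 -> bf A u v = 0 -> tot_sing A (u + v)%MS.
Proof.
move=> u0 v0 uv0; apply/tot_singP=> _ /mem_adds_rV[a [c ->]].
by rewrite qf_lin u0 v0 uv0 !mulr0 !addr0.
Qed.

Lemma nonsingularP (W : 'M[F]_6) :
  reflect (forall v, (v <= W)%MS -> qf A v = 0 ->
             (forall w, (w <= W)%MS -> bf A v w = 0) -> v = 0)
          (nonsingular_on A W).
Proof.
apply: (iffP forallP) => W0 v => [vW v0 vW0|].
  apply/eqP/(implyP (W0 v)); rewrite vW v0 eqxx /=.
  by apply/forallP=> w; apply/implyP=> /vW0 ->.
apply/implyP=> /and3P[vW /eqP v0 /forallP vW0]; apply/eqP/W0 => // w wW.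
by apply/eqP/(implyP (vW0 w)).
Qed.

(** As [s] is singular, [f(v - t s)] is affine in [t], with root [f(v) / b(v, s)]. *)
Lemma qf_shift v s : qf A s = 0 -> bf A v s != 0 -> qf A (v - (qf A v / bf A v s) *: s) = 0.
Proof.
move=> s0 vs; rewrite -[v in v - _]scale1r -scaleNr qf_lin s0.
by field.
Qed.

(* v + s' and s' are both shifted into the quadric when v is orthogonal to s. *)
Lemma singular_span m (S : 'M[F]_(m, 6)) s s' v y :
  (s <= S)%MS -> (s' <= S)%MS -> qf A s = 0 -> bf A s s' != 0 ->
  (forall w, (w <= S)%MS -> qf A w = 0 -> bf A w y = 0) ->
  (v <= S)%MS -> bf A v y = 0.
Proof.
move=> sS s'S s0 ss' Sy.
have key w : (w <= S)%MS -> bf A w s != 0 -> bf A w y = 0.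
  move=> wS ws; have := Sy (w - (qf A w / bf A w s) *: s).
  rewrite addmx_sub ?eqmx_opp ?scalemx_sub // qf_shift // => /(_ isT erefl).
  by rewrite -scaleNr bfDl bfZl (Sy s) // mulr0 addr0.
move=> vS; have [vs0|] := eqVneq (bf A v s) 0; last exact: key.
have := key (v + s'); rewrite addmx_sub // bfDl vs0 add0r bf_sym ss' => /(_ isT isT).
by rewrite bfDl (key s') // ?addr0 // bf_sym.
Qed.

End QuadraticForm.

(** * Square roots, the Artin-Schreier map and alternating forms in characteristic 2 *)

Section EvenCharacteristic.
Variables (F : finFieldType) (n : nat).
Hypothesis HF : #|F| = (2 ^ n)%N.
Implicit Types (a c : F).

Lemma char2_addrr a : a + a = 0.
Proof.
have c2 := card_finPcharP HF isT.
by rewrite -mulr2n -mulr_natl (pcharf0 c2) mul0r.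
Qed.

Lemma char2_oppr a : - a = a.
Proof. by apply/eqP; rewrite -subr_eq0 -opprD char2_addrr oppr0. Qed.

(** Squaring is the Frobenius map, whose inverse on a field of order [2 ^ n] is the power
    [2 ^ (n - 1)]. *)
Lemma char2_sqrt a : exists c, c ^+ 2 = a.
Proof.
case: n HF => [|m] cF; first by have := finNzRing_gt1 F; rewrite cF.
by exists (a ^+ (2 ^ m)); rewrite -exprM mulnC -expnS -cF expf_card.
Qed.

(* t |-> t + a t^2 is additive with kernel {0, 1/a}, so its image has index 2. *)
Lemma artin_schreier_index2 a c1 c2 : a != 0 ->
  (forall t, c1 + t + t ^+ 2 * a != 0) -> (forall t, c2 + t + t ^+ 2 * a != 0) ->
  exists t, c1 = c2 + t + t ^+ 2 * a.
Proof.
move=> a0 N1 N2; pose h t := t + t ^+ 2 * a; pose I := h @: [set: F].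
have hD t s : h (t + s) = h t + h s.
  have -> : h (t + s) = h t + h s + (t * s * a + t * s * a) by rewrite /h; ring.
  by rewrite char2_addrr addr0.
(* Arguments with the same image differ by [0] or [a^-1], so fibres of [h] have at most two
   elements. *)
have Fle : (#|F| <= #|I|.*2)%N.
  rewrite -cardsT -sum1_card (partition_big_imset h) /= -muln2 -sum_nat_const.
  apply: leq_sum => y /imsetP[t0 _ ->]; rewrite sum1dep_card.
  apply: (@leq_trans #|[set t0; t0 + a^-1]|); last by rewrite cards2; case: (_ == _).
  apply/subset_leq_card/subsetP=> t; rewrite !inE /= => /eqP tt0.
  have : (t - t0) * (1 + (t - t0) * a) = 0.
    have <- : h (t - t0) = 0 by rewrite hD tt0 -hD subrr /h expr0n mul0r addr0.
    by rewrite /h; ring.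
  move/eqP; rewrite mulf_eq0 subr_eq0 => /orP[-> //|/eqP E]; apply/orP; right.
  apply/eqP; have -> : t = t0 + (t - t0) by ring.
  congr (_ + _); apply: (mulIf a0); rewrite mulVf //.
  by apply/eqP; rewrite -[1]char2_oppr -addr_eq0 addrC E.
have notI c : (forall t, c + t + t ^+ 2 * a != 0) -> c \notin I.
  move=> N; apply/imsetP=> -[t _ ct]; case/negP: (N t).
  by rewrite -addrA ct char2_addrr.
(* By counting, [I] and its coset by [c1] fill the field; [c2] lies outside [I], hence in the
   coset. *)
pose J := [set c1 + y | y in I].
have cJ : #|J| = #|I| by apply: card_imset; apply: addrI.
have IJ : [disjoint I & J].
  apply/pred0P=> y /=; apply/negP=> /andP[/imsetP[t _ ->] /imsetP[_ /imsetP[s _ ->] E]].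
  case/negP: (notI _ N1); apply/imsetP; exists (t - s) => //.
  by rewrite hD E char2_oppr -addrA char2_addrr addr0.
have : c2 \in I :|: J.
  suff /eqP-> : I :|: J == setT by rewrite inE.
  rewrite eqEcard subsetT cardsT (leq_trans Fle) // cardsU disjoint_setI0 // cards0 subn0 cJ.
  by rewrite addnn.
rewrite inE (negPf (notI _ N2)) /= => /imsetP[_ /imsetP[t _ ->] ->]; exists t.
by rewrite -/(h t) -addrA -addrA -/(h t) char2_addrr addr0.
Qed.

Variable A : 'M[F]_6.
Implicit Types (u v w : 'rV[F]_6) (W : 'M[F]_6).

Lemma bf_alt v : bf A v v = 0.
Proof. by rewrite bf_self char2_addrr. Qed.

(** With [b(u, v) = 0] the form takes the value [c^2 f(u) + f(v)] at [c u + v], and every field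
    element is a square. *)
Lemma singular_in_line u v : u != 0 -> ~~ (v <= u)%MS -> bf A u v = 0 ->
  exists w, [/\ (w <= u + v)%MS, w != 0 & qf A w = 0].
Proof.
move=> u0 vu uv0; have [fu0|fu] := eqVneq (qf A u) 0.
  by exists u; rewrite addsmxSl.
have [c cE] := char2_sqrt (qf A v / qf A u).
exists (c *: u + 1 *: v); split.
- by apply/mem_adds_rV; exists c, 1.
- apply: contraNneq vu => /eqP; rewrite addrC addr_eq0 scale1r => /eqP->.
  by rewrite eqmx_opp scalemx_sub.
- by rewrite qf_lin uv0 cE divfK // mulr0 addr0 expr1n mul1r char2_addrr.
Qed.

Lemma singular_of_isotropic W : (1 < \rank W)%N ->
  (forall u v, (u <= W)%MS -> (v <= W)%MS -> bf A u v = 0) ->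
  exists w, [/\ (w <= W)%MS, w != 0 & qf A w = 0].
Proof.
move=> rW W0; have [u uW u0] : exists2 u : 'rV_6, (u <= W)%MS & u != 0.
  by apply/rowV0Pn; rewrite -mxrank_eq0 -lt0n ltnW.
have [v vW vu] := ex_not_sub u rW.
have [w [wuv w0 fw]] := singular_in_line u0 vu (W0 u v uW vW).
by exists w; split=> //; rewrite (submx_trans wuv) // addsmx_sub uW.
Qed.

(** The space orthogonal to [u] meets [W] in rank at least 2, which leaves a vector orthogonal to
    [u] and independent of it. *)
Lemma singular_of_rank3 W : (2 < \rank W)%N ->
  exists w, [/\ (w <= W)%MS, w != 0 & qf A w = 0].
Proof.
move=> rW; have [u uW u0] : exists2 u : 'rV_6, (u <= W)%MS & u != 0.
  by apply/rowV0Pn; rewrite -mxrank_eq0 -lt0n (leq_trans _ rW).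
have [|v] := @ex_not_sub _ (W :&: perp A u)%MS u.
  have := mxrank_sum_cap W (perp A u); have := rank_perp_ge A u.
  have := rank_leq_col (W + perp A u)%MS; rewrite rank_rV u0; lia.
rewrite sub_capmx perp_rVP => /andP[vW /eqP vu0] vu.
have [|w [wuv w0 fw]] := singular_in_line u0 vu; first by rewrite bf_sym.
by exists w; split=> //; rewrite (submx_trans wuv) // addsmx_sub uW.
Qed.

Lemma hyperbolic_decomp W u v w : (u <= W)%MS -> (v <= W)%MS -> bf A u v != 0 -> (w <= W)%MS ->
  exists a c w', [/\ w = a *: u + c *: v + w', (w' <= W)%MS, bf A w' u = 0 & bf A w' v = 0].
Proof.
(* Since [b(u, u) = b(v, v) = 0], the coefficient of [u] is found by pairing with [v], and that of
   [v] by pairing with [u]. *)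
move=> uW vW uv wW; set a := bf A w v / bf A u v; set c := bf A w u / bf A u v.
exists a, c, (w - (a *: u + c *: v)); split; first by rewrite addrC subrK.
- by rewrite addmx_sub ?eqmx_opp ?addmx_sub ?scalemx_sub.
- by rewrite bfDl -scaleN1r bfZl bf_lin bf_alt (bf_sym _ v) /c; field.
- by rewrite bfDl -scaleN1r bfZl bf_lin bf_alt /a; field.
Qed.

(** [W] is the direct sum of the plane [<u, v>], on which [b] is nondegenerate, and its orthogonal
    complement in [W]. *)
Lemma hyperbolic_rank W u v : (u <= W)%MS -> (v <= W)%MS -> bf A u v != 0 ->
  (\rank (W :&: perp A (u + v)%MS) + 2 = \rank W)%N.
Proof.
move=> uW vW uv; set P := perp A _.
have ruv : \rank (u + v)%MS = 2%N.
  apply: rank_add_rV; first by apply: contraNneq uv => ->; rewrite bf0l.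
  by apply: contra uv => /sub_rVP[a ->]; rewrite bfZr bf_alt mulr0.
have cap0 : ((W :&: P) :&: (u + v) = 0)%MS.
  apply/eqP/rowV0P=> w; rewrite !sub_capmx perp_addsP !perp_rVP.
  case/andP=> /and3P[_ /eqP wu /eqP wv] /mem_adds_rV[a [c E]].
  move: wu wv; rewrite E !bf_lin !bf_alt (bf_sym _ v) !mulr0 addr0 add0r.
  by move/eqP; rewrite mulf_eq0 (negPf uv) orbF => /eqP-> /eqP;
     rewrite mulf_eq0 (negPf uv) orbF => /eqP->; rewrite !scale0r addr0.
have := mxrank_sum_cap (W :&: P)%MS (u + v)%MS; rewrite cap0 mxrank0 addn0 ruv => <-.
apply/eqP; rewrite eqn_leq; apply/andP; split; apply: mxrankS.
  by rewrite !addsmx_sub capmxSl uW vW.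
apply/row_subP=> i; have [a [c [w [-> wW wu wv]]]] := hyperbolic_decomp uW vW uv (row_sub i W).
rewrite addrC addmx_sub_adds //; last by apply/mem_adds_rV; exists a, c.
by rewrite sub_capmx wW perp_addsP !perp_rVP wu wv !eqxx.
Qed.

(** An alternating form has even rank: splitting off a pair with [b(u, v) != 0] lowers the rank of
    [W] by 2 and leaves the radical unchanged. *)
Lemma odd_rank_radical W : odd (\rank W) = odd (\rank (W :&: perp A W)).
Proof.
have [k] := ubnP (\rank W); elim: k => // k IHk in W *; rewrite ltnS => rW.
have [WW|/row_subPn[i]] := boolP (W <= perp A W)%MS; first by rewrite (capmx_idPl WW).
set u := row i W => uW; have uWW : (u <= W)%MS by apply: row_sub.
have [v vW uv] := ex_not_orthogonal uW.
have rD := hyperbolic_rank uWW vW uv; set D := (W :&: _)%MS in rD.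
rewrite -rD oddD addbF IHk; last by rewrite -rD in rW; lia.
have DD w : (w <= D)%MS = [&& (w <= W)%MS, bf A w u == 0 & bf A w v == 0].
  by rewrite /D sub_capmx perp_addsP !perp_rVP.
clearbody D; suff /eqmxP-> : (D :&: perp A D == W :&: perp A W)%MS by [].
apply/andP; split; apply/rV_subP=> w; rewrite !sub_capmx.
  rewrite DD => /andP[/and3P[wW /eqP wu /eqP wv] wD]; rewrite wW; apply/perpP=> z zW.
  have [a [c [z' [-> z'W zu zv]]]] := hyperbolic_decomp uWW vW uv zW.
  by rewrite !bfDr !bfZr wu wv !mulr0 !add0r (perp_bf wD) // DD z'W zu zv eqxx.
case/andP=> wW wp; rewrite DD wW !(perp_bf wp) // eqxx /=.
by apply/perpP=> z; rewrite DD => /andP[zW _]; apply: perp_bf zW.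
Qed.

(** [nonsingular_on] only excludes singular vectors from the radical. In even rank the radical has
    even rank; if nonzero, it would be totally isotropic of rank at least 2 and so contain a
    singular vector. *)
Lemma nonsingular_radical W : nonsingular_on A W -> ~~ odd (\rank W) -> (W :&: perp A W = 0)%MS.
Proof.
move=> /nonsingularP nsW; rewrite odd_rank_radical => rR.
apply/eqP; rewrite -mxrank_eq0; case: (ltngtP (\rank (W :&: perp A W)) 1) rR => [|r2|->//].
  by case: (\rank _).
have [|w [wR w0 fw]] := singular_of_isotropic r2.
  by move=> u v; rewrite !sub_capmx => /andP[_ up] /andP[vW _]; apply: perp_bf up vW.
case/eqP: w0; apply: nsW => //; move: wR; rewrite sub_capmx => /andP[] // _ wp z.
exact: perp_bf.
Qed.

End EvenCharacteristic.

Lemma sub_of_rank (K : fieldType) m1 m2 k (U : 'M[K]_(m1, k)) (W : 'M[K]_(m2, k)) :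
  (U <= W)%MS -> (\rank W <= \rank U)%N -> (W <= U)%MS.
Proof. by move=> UW; rewrite (geq_leqif (mxrank_leqif_sup UW)). Qed.

(** * Vector representatives of projective points *)

Section ProjectivePoints.
Variables (F : finFieldType).
Implicit Types (u v w x : 'rV[F]_6) (W p : 'M[F]_6).

Lemma is_point_rV v : is_point <<v>>%MS = (v != 0).
Proof. by rewrite /is_point genmx_id eqxx andbT genmxE rank_rV; case: (v == 0). Qed.

Lemma is_pointP p : reflect (exists2 v : 'rV[F]_6, v != 0 & p = <<v>>%MS) (is_point p).
Proof.
apply: (iffP idP) => [/andP[/eqP rp /eqP <-]|[v v0 ->]]; last by rewrite is_point_rV.
have p0 : nz_row p != 0 by rewrite nz_row_eq0 -mxrank_eq0 rp.
exists (nz_row p) => //; apply/esym/genmxP; apply/andP; split; first exact: nz_row_sub.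
by apply: sub_of_rank; rewrite ?nz_row_sub // rank_rV p0 rp.
Qed.

Lemma point_eq u v : u != 0 -> (u <= v)%MS -> <<u>>%MS = <<v>>%MS.
Proof.
move=> u0 uv; apply/genmxP; rewrite uv; apply: sub_of_rank => //.
by rewrite !rank_rV u0 leq_b1.
Qed.

Lemma point_sub u v : <<u>>%MS = <<v>>%MS -> (u <= v)%MS.
Proof. by move/genmxP/andP=> []. Qed.

Lemma mem_pts_of v W : v != 0 -> (<<v>>%MS \in pts_of W) = (v <= W)%MS.
Proof. by move=> v0; rewrite inE is_point_rV v0 genmxE. Qed.

Lemma mem_quadric (A : 'M[F]_6) v : v != 0 -> (<<v>>%MS \in quadric A) = (qf A v == 0).
Proof. by move=> v0; rewrite inE is_point_rV v0 tot_sing_rV. Qed.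

Lemma mem_perp_pts (A : 'M[F]_6) x v :
  v != 0 -> (<<v>>%MS \in perp_pts A <<x>>%MS) = (bf A x v == 0).
Proof.
move=> v0; rewrite inE is_point_rV v0 /=; apply/forallP/eqP => [xv|xv u].
  by apply/eqP; move/forallP/(_ v): (xv x); rewrite !genmxE !submx_refl.
apply/forallP=> w; rewrite !genmxE; apply/implyP=> /andP[/sub_rVP[a ->] /sub_rVP[c ->]].
by rewrite bfZl bfZr xv !mulr0.
Qed.

End ProjectivePoints.

(** * Consequences of Witt index 2 in dimension 6 *)

Section EllipticQuadric.
Variables (F : finFieldType) (n : nat).
Hypothesis HF : #|F| = (2 ^ n)%N.
Variable A : 'M[F]_6.
Hypothesis HQ : nonsingular_on A 1%:M && witt_index_on A 1%:M 2.
Implicit Types (u v w x y : 'rV[F]_6) (W U L : 'M[F]_6).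

Let alt := bf_alt HF A.

Lemma tot_sing_rank U : tot_sing A U -> (\rank U <= 2)%N.
Proof.
case/andP: HQ => _ /andP[_ /forallP/(_ U)/implyP H] tU.
by apply: H; rewrite submx1.
Qed.

(** Otherwise [U] and [v] would span a totally singular space of rank 3. *)
Lemma tot_sing_max U v : tot_sing A U -> \rank U = 2%N -> qf A v = 0 ->
  (forall u, (u <= U)%MS -> bf A u v = 0) -> (v <= U)%MS.
Proof.
move=> tU rU v0 Uv; have /tot_sing_rank rUv : tot_sing A (U + v)%MS.
  apply: tot_sing_adds => // [w /sub_rVP[a ->]|u w uU /sub_rVP[a ->]].
    by rewrite qfZ v0 mulr0.
  by rewrite bfZr Uv ?mulr0.
have : (U + v <= U)%MS by apply: sub_of_rank; rewrite ?addsmxSl ?rU.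
by rewrite addsmx_sub => /andP[].
Qed.

(** The rank 6 of the whole space is even, so the radical of [b] is zero and [A + A^T] is
    invertible. *)
Lemma rank_perp m (W : 'M[F]_(m, 6)) : \rank (perp A W) = (6 - \rank W)%N.
Proof.
case/andP: HQ => ns _; have := nonsingular_radical HF ns.
rewrite mxrank1 => /(_ isT) /eqP; rewrite cap1mx /perp trmx1 mulmx1 kermx_eq0.
move=> Mfree.
have Msym : (A + A^T)^T = A + A^T by rewrite linearD /= trmxK addrC.
by rewrite mxrank_ker -(mxrank_tr (_ *m _)) trmx_mul trmxK Msym mxrankMfree.
Qed.

Lemma perp_perp m (W : 'M[F]_(m, 6)) v : (v <= perp A (perp A W))%MS = (v <= W)%MS.
Proof.
have sW : (W <= perp A (perp A W))%MS.
  apply/row_subP=> i; apply/perpP=> w wW.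
  by rewrite bf_sym (perp_bf wW) ?row_sub.
have : (perp A (perp A W) <= W)%MS.
  by apply: sub_of_rank; rewrite // !rank_perp subKn // rank_leq_col.
by move=> sW'; apply/idP/idP=> /submx_trans; apply.
Qed.

(** The orthogonal of a hyperplane is a point [N]. As [b] is alternating, [N] lies in [H = N^perp]
    and in its radical, so nonsingularity on [H] forces [f(N) != 0]. *)
Lemma perp_nucleus (H : 'M[F]_6) : \rank H = 5%N -> nonsingular_on A H ->
  exists N, qf A N != 0 /\ forall v, (v <= H)%MS = (bf A v N == 0).
Proof.
move=> rH /nonsingularP nsH.
have [N NH N0] : exists2 N : 'rV_6, (N <= perp A H)%MS & N != 0.
  by apply/rowV0Pn; rewrite -mxrank_eq0 rank_perp rH.
have EN : (perp A H <= N)%MS by apply: sub_of_rank; rewrite // rank_rV N0 rank_perp rH.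
have HE v : (v <= H)%MS = (bf A v N == 0).
  rewrite -perp_perp; apply/perpP/eqP => [|vN w /submx_trans/(_ EN)/sub_rVP[a ->]].
    by apply.
  by rewrite bfZr vN mulr0.
exists N; split=> //; apply: contraNneq N0 => fN; apply/eqP/nsH => //.
  by rewrite HE alt.
by move=> w; rewrite HE bf_sym => /eqP.
Qed.

(** * The nucleus and the map on points *)

Variables (H0 : 'M[F]_6) (N : 'rV[F]_6).
Hypothesis fN : qf A N != 0.
Hypothesis HN : forall v, (v <= H0)%MS = (bf A v N == 0).

Lemma nonzero_of_affine x : bf A x N != 0 -> x != 0.
Proof. by apply: contraNneq => ->; rewrite bf0l. Qed.

Lemma mem_hatX x : (<<x>>%MS \in hatX_points A H0) = (qf A x == 0) && (bf A x N != 0).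
Proof.
have [->|x0] := eqVneq x 0.
  by rewrite bf0l eqxx andbF !inE is_point_rV eqxx !andbF.
by rewrite inE inE mem_quadric // mem_pts_of // HN; case: (qf A x == 0); rewrite ?andbF ?andbT.
Qed.

Lemma hatX_pointsP (X : 'M[F]_6) : X \in hatX_points A H0 ->
  exists x, [/\ X = <<x>>%MS, qf A x = 0 & bf A x N != 0].
Proof.
move=> XX; have /is_pointP[x x0 EX] : is_point X by move: XX; rewrite !inE => /andP[_ /andP[]].
by exists x; move: XX; rewrite EX mem_hatX => /andP[/eqP].
Qed.

Lemma mem_Q0 v : v != 0 -> (<<v>>%MS \in Q0 A H0) = (qf A v == 0) && (bf A v N == 0).
Proof. by move=> v0; rewrite inE mem_quadric // mem_pts_of // HN. Qed.

Lemma mem_phi0 x v : v != 0 ->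
  (<<v>>%MS \in phi0_pt A H0 <<x>>%MS) = [&& bf A x v == 0, qf A v == 0 & bf A v N == 0].
Proof. by move=> v0; rewrite in_setI mem_Q0 // mem_perp_pts. Qed.

Lemma points_eq (X Y : {set 'M[F]_6}) : X \subset quadric A -> Y \subset quadric A ->
  (forall v, v != 0 -> (<<v>>%MS \in X) = (<<v>>%MS \in Y)) -> X = Y.
Proof.
move=> /subsetP XQ /subsetP YQ XY; apply/setP=> p.
have [|Np] := boolP (is_point p); first by case/is_pointP=> v v0 ->; apply: XY.
have NQ : p \notin quadric A by rewrite inE (negPf Np).
by rewrite (negPf (contra (XQ p) NQ)) (negPf (contra (YQ p) NQ)).
Qed.

Lemma Q0_sub_quadric (X : {set 'M[F]_6}) : X :&: Q0 A H0 \subset quadric A.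
Proof. by rewrite setIC -setIA subsetIl. Qed.

(** Points of [Q_0] are orthogonal to [N], so they pair with [x + c N] as with [x]. *)
Lemma phi0_translate_N x c : phi0_pt A H0 <<x + c *: N>>%MS = phi0_pt A H0 <<x>>%MS.
Proof.
apply: points_eq => [||v v0]; try exact: Q0_sub_quadric.
rewrite !mem_phi0 // bfDl bfZl (bf_sym A N); have [->|] := eqVneq (bf A v N) 0.
  by rewrite mulr0 addr0.
by rewrite !andbF.
Qed.

(** For affine [x], the 4-space carrying its ovoid: the part of [x^perp] inside [H_0]. *)
Let S x := perp A (x + N)%MS.

Lemma mem_S x v : (v <= S x)%MS = (bf A v x == 0) && (bf A v N == 0).
Proof. by rewrite /S perp_addsP !perp_rVP. Qed.

Lemma rank_line_N x : bf A x N != 0 -> \rank (x + N)%MS = 2%N.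
Proof.
move=> xN; apply: rank_add_rV; first exact: nonzero_of_affine.
by apply: contra xN => /sub_rVP[a ->]; rewrite bfZr alt mulr0.
Qed.

Lemma rank_S x : bf A x N != 0 -> \rank (S x) = 4%N.
Proof. by move=> xN; rewrite rank_perp rank_line_N. Qed.

(** The radical is the intersection of [<x, N>^perp] with its own orthogonal [<x, N>], and [b] is
    nondegenerate on [<x, N>]. *)
Lemma S_radical x v : bf A x N != 0 -> (v <= S x)%MS ->
  (forall w, (w <= S x)%MS -> bf A v w = 0) -> v = 0.
Proof.
move=> xN + /perpP; rewrite mem_S perp_perp => /andP[vx vN] /mem_adds_rV[a [c E]].
move: vx vN; rewrite E !bf_lin !alt (bf_sym A N) !mulr0 add0r addr0 !mulf_eq0 (negPf xN) !orbF.
by move=> /eqP-> /eqP->; rewrite !scale0r addr0.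
Qed.

Lemma phi0_ovoid x : qf A x = 0 -> bf A x N != 0 -> phi0_pt A H0 <<x>>%MS \in ovoids A H0.
Proof.
move=> fx xN; rewrite inE; apply/existsP; exists (S x); apply/and5P; split.
- by apply/rV_subP=> v; rewrite mem_S HN => /andP[].
- by rewrite rank_S.
- by apply/nonsingularP=> v vS _; apply: S_radical.
- apply/andP; split.
    have [|s [sS s0 fs]] := @singular_of_rank3 _ _ HF A (S x); first by rewrite rank_S.
    by apply/existsP; exists <<s>>%MS; rewrite genmxE sS mxrank_gen rank_rV s0 tot_sing_rV fs eqxx.
  (* [x] is singular, orthogonal to [S x], and outside it because [b(x, N) != 0]; adding it to [U]
     gives a totally singular space of larger rank, still at most 2. *)
  apply/forallP=> U; apply/implyP=> /andP[US tU].
  have /tot_sing_rank : tot_sing A (U + x)%MS.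
    apply: tot_sing_adds => // [w /sub_rVP[a ->]|u w uU /sub_rVP[a ->]].
      by rewrite qfZ fx mulr0.
    by have := submx_trans uU US; rewrite mem_S bfZr => /andP[/eqP-> _]; rewrite mulr0.
  move=> rUx; rewrite -ltnS (leq_trans _ rUx) // rank_ltmx // ltmxE addsmxSl addsmx_sub submx_refl /=.
  by apply: contra xN => /submx_trans/(_ US); rewrite mem_S => /andP[_].
- apply/eqP; apply: points_eq => [||v v0].
  + exact: Q0_sub_quadric.
  + by rewrite setIC Q0_sub_quadric.
  + rewrite mem_phi0 // in_setI mem_Q0 // mem_pts_of // mem_S bf_sym.
    by case: (bf A v N == 0); rewrite ?andbF ?andbT // andbC.
Qed.

(** Singular vectors span [S x], so [y] is orthogonal to all of [S x] and lies in its orthogonal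
    [<x, N>]. *)
Lemma phi0_inj x y : bf A x N != 0 -> phi0_pt A H0 <<x>>%MS = phi0_pt A H0 <<y>>%MS ->
  (y <= x + N)%MS.
Proof.
move=> xN Exy; have [|s [sS s0 fs]] := @singular_of_rank3 _ _ HF A (S x); first by rewrite rank_S.
have [|s' s'S ss'] := @ex_not_orthogonal _ A _ (S x) s.
  by apply: contraNN s0 => /perpP sp; rewrite (S_radical xN sS).
rewrite -perp_perp; apply/perpP=> v vS; rewrite bf_sym.
apply: (singular_span sS s'S) => // w; rewrite mem_S => /andP[wx wN] fw.
have [->|w0] := eqVneq w 0; first by rewrite bf0l.
have := mem_phi0 x w0; rewrite Exy mem_phi0 // fw (bf_sym A x) wx wN eqxx /= andbT.
by move/eqP; rewrite bf_sym.
Qed.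

(** * Anisotropic planes, and every elliptic ovoid as an image *)

Lemma anisotropic_not_orthogonal W : (1 < \rank W)%N ->
  (forall w, (w <= W)%MS -> qf A w = 0 -> w = 0) ->
  exists u v, [/\ (u <= W)%MS, (v <= W)%MS & bf A u v = 1].
Proof.
move=> rW W0; have [u uW u0] : exists2 u : 'rV_6, (u <= W)%MS & u != 0.
  by apply/rowV0Pn; rewrite -mxrank_eq0 -lt0n ltnW.
have [v vW vu] := ex_not_sub u rW.
have uv : bf A u v != 0.
  apply/eqP=> uv0; have [w [wuv /eqP w0 fw]] := singular_in_line HF u0 vu uv0.
  by apply: w0; apply: W0 => //; rewrite (submx_trans wuv) // addsmx_sub uW.
by exists u, ((bf A u v)^-1 *: v); rewrite scalemx_sub // bfZr mulVf.
Qed.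

(* Anisotropic planes over a finite field are all similar, and in characteristic 2
   the graph of an isometry between orthogonal planes is totally singular. *)
Lemma anisotropic_pair U W : (1 < \rank U)%N -> (1 < \rank W)%N ->
  (forall u, (u <= U)%MS -> qf A u = 0 -> u = 0) ->
  (forall w, (w <= W)%MS -> qf A w = 0 -> w = 0) ->
  (forall u w, (u <= U)%MS -> (w <= W)%MS -> bf A u w = 0) ->
  exists d1 d2 e1 e2, [/\ [/\ (d1 <= U)%MS, (d2 <= U)%MS, (e1 <= W)%MS & (e2 <= W)%MS],
    bf A d1 d2 != 0, qf A (d1 + e1) = 0, qf A (d2 + e2) = 0 & bf A (d1 + e1) (d2 + e2) = 0].
Proof.
move=> rU rW aU aW UW.
have [d1 [d2 [d1U d2U d12]]] := anisotropic_not_orthogonal rU aU.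
have [e1 [e2 [e1W e2W e12]]] := anisotropic_not_orthogonal rW aW.
have neq0 u v : bf A u v = 1 -> u != 0.
  by move=> uv; apply/eqP=> u0; move/eqP: uv; rewrite u0 bf0l eq_sym oner_eq0.
have fd1 : qf A d1 != 0 by apply: contraNneq (neq0 _ _ d12) => /aU->.
have fe1 : qf A e1 != 0 by apply: contraNneq (neq0 _ _ e12) => /aW->.
have [k kE] := char2_sqrt HF (qf A d1 / qf A e1).
have k0 : k != 0.
  by apply: contraNneq fd1 => k0; move/eqP: kE; rewrite k0 expr0n eq_sym mulf_eq0 invr_eq0 (negPf fe1) orbF.
have fke1 : qf A (k *: e1) = qf A d1 by rewrite qfZ kE divfK.
have ke12 : bf A (k *: e1) (k^-1 *: e2) = 1 by rewrite bfZl bfZr mulrA divff // mul1r.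
(* The expression is [f(t u + v)], and [t u + v] is nonzero because it pairs with [u] to 1. *)
have aniso u v (V : 'M_6) : (u <= V)%MS -> (v <= V)%MS -> bf A u v = 1 ->
    (forall w, (w <= V)%MS -> qf A w = 0 -> w = 0) ->
    forall t, qf A v + t + t ^+ 2 * qf A u != 0.
  move=> uV vV uv aV t; have -> : qf A v + t + t ^+ 2 * qf A u = qf A (t *: u + 1 *: v).
    by rewrite qf_lin uv; ring.
  apply/eqP=> /aV; rewrite addmx_sub ?scalemx_sub // => /(_ isT) E.
  have /eqP := bf0r A u; rewrite -E bfDr !bfZr uv alt mulr0 add0r mulr1.
  by rewrite oner_eq0.
(* The [eq_ind] term replaces [f(k e1)] by [f(d1)], so that both planes give the same Artin-Schreier
   map. *)
have [t tE] := artin_schreier_index2 HF fd1 (aniso _ _ _ d1U d2U d12 aU)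
  (fun t => eq_ind _ (fun a => _ + t + t ^+ 2 * a != 0)
     (aniso _ _ W (scalemx_sub k e1W) (scalemx_sub k^-1 e2W) ke12 aW t) _ fke1).
set g1 := k *: e1 in fke1 ke12 *.
(* Adding [t g1] corrects [f(k^-1 e2)] to [f(d2)] without changing the product with [g1]. *)
have g1W : (g1 <= W)%MS by rewrite scalemx_sub.
clearbody g1; pose g2 := t *: g1 + 1 *: (k^-1 *: e2).
have g2W : (g2 <= W)%MS by rewrite addmx_sub ?scalemx_sub.
have g12 : bf A g1 g2 = 1 by rewrite bfDr (bfZr A t) (bfZr A 1) alt ke12 mulr0 add0r mulr1.
have fg2 : qf A g2 = qf A d2 by rewrite qf_lin ke12 fke1 tE; ring.
clearbody g2; exists d1, d2, g1, g2; split=> //.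
- by rewrite d12 oner_eq0.
- by rewrite qfD fke1 UW // addr0 (char2_addrr HF).
- by rewrite qfD fg2 UW // addr0 (char2_addrr HF).
- by rewrite bfDl !bfDr d12 g12 (bf_sym A g1) !UW // addr0 add0r (char2_addrr HF).
Qed.

Lemma nondegenerate_perp_singular W : \rank W = 4%N -> nonsingular_on A W ->
  (forall U, (U <= W)%MS -> tot_sing A U -> (\rank U <= 1)%N) ->
  exists x, [/\ (x <= perp A W)%MS, x != 0 & qf A x = 0].
Proof.
move=> rW nsW ind; have rad0 := nonsingular_radical HF nsW; rewrite rW in rad0.
have [|s [sW s0 fs]] := @singular_of_rank3 _ _ HF A W; first by rewrite rW.
have [|s' s'W ss'] := @ex_not_orthogonal _ A _ W s.
  by apply: contraNN s0 => sp; rewrite -submx0 -rad0 // sub_capmx sW.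
have rD := hyperbolic_rank HF sW s'W ss'; set D := (W :&: _)%MS in rD.
have DD w : (w <= D)%MS = [&& (w <= W)%MS, bf A w s == 0 & bf A w s' == 0].
  by rewrite /D sub_capmx perp_addsP !perp_rVP.
clearbody D; rewrite rW in rD.
have [/existsP[x /and3P[xW x0 /eqP fx]]|noE] :=
  boolP [exists x : 'rV_6, [&& (x <= perp A W)%MS, x != 0 & qf A x == 0]]; first by exists x.
(* A nonzero singular [d] in [D] would span with [s] a totally singular line inside [W]. *)
have aD d : (d <= D)%MS -> qf A d = 0 -> d = 0.
  rewrite DD => /and3P[dW /eqP ds /eqP ds'] fd; apply/eqP/negPn/negP=> d0.
  have /ind : (s + d <= W)%MS by rewrite addsmx_sub sW.
  rewrite tot_sing_adds_rV // 1?bf_sym // => /(_ isT).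
  rewrite rank_add_rV //; apply: contra d0 => /sub_rVP[a E]; move: ds'; rewrite E bfZl.
  by move/eqP; rewrite mulf_eq0 (negPf ss') orbF => /eqP->; rewrite scale0r.
have aE e : (e <= perp A W)%MS -> qf A e = 0 -> e = 0.
  move=> eW fe; apply/eqP/negPn/negP=> e0; case/existsP: noE; exists e.
  by rewrite eW e0 fe eqxx.
have DE d e : (d <= D)%MS -> (e <= perp A W)%MS -> bf A d e = 0.
  by rewrite DD => /and3P[dW _ _] eW; rewrite bf_sym (perp_bf eW).
have [|||||d1 [d2 [e1 [e2 [[d1D d2D e1E e2E] d12 f1 f2 b12]]]]] := @anisotropic_pair D (perp A W) => //.
  by rewrite -(ltn_add2r 2) rD.
  by rewrite rank_perp rW.
(* Pairing with [d1] and [d2] reads off the coordinates of a vector of the line through [d1 + e1]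
   and [d2 + e2]; [s] is orthogonal to both, so its coordinates would vanish. *)
have b1 : bf A (d1 + e1) d1 = 0 by rewrite bfDl alt (bf_sym A e1) (DE d1) ?addr0.
have b2 : bf A (d1 + e1) d2 != 0 by rewrite bfDl (bf_sym A e1) (DE d2) ?addr0.
have b3 : bf A (d2 + e2) d1 != 0 by rewrite bfDl (bf_sym A e2) (DE d1) ?addr0 // bf_sym.
have b4 : bf A (d2 + e2) d2 = 0 by rewrite bfDl alt (bf_sym A e2) (DE d2) ?addr0.
(* This line is totally singular and orthogonal to [s], hence contains [s] by maximality. *)
have sT : (s <= (d1 + e1)%R + (d2 + e2)%R)%MS.
  apply: tot_sing_max => //; first exact: tot_sing_adds_rV.
    apply: rank_add_rV; first by apply: contraNneq b2 => ->; rewrite bf0l.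
    by apply: contra b3 => /sub_rVP[a ->]; rewrite bfZl b1 mulr0.
  move=> _ /mem_adds_rV[a [c ->]]; move: d1D d2D; rewrite !DD => /and3P[_ /eqP d1s _] /and3P[_ /eqP d2s _].
  by rewrite bf_lin !bfDl d1s d2s !(perp_bf _ sW) // !addr0 !mulr0 addr0.
case/mem_adds_rV: sT => a [c sE]; case/eqP: s0.
have sd d : (d <= D)%MS -> bf A s d = 0 by rewrite DD bf_sym => /and3P[_ /eqP].
have := sd d1 d1D; have := sd d2 d2D; rewrite {1 2}sE !bf_lin b1 b4 !mulr0 addr0 add0r.
move=> /eqP; rewrite mulf_eq0 (negPf b2) orbF => /eqP a0.
move=> /eqP; rewrite mulf_eq0 (negPf b3) orbF => /eqP c0.
by rewrite sE a0 c0 !scale0r addr0.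
Qed.

(** The singular [x] found in [W^perp] and the vector [N], which is orthogonal to [W] because [W]
    lies in [H_0], span [W^perp]; so [W = S x]. *)
Lemma ovoid_phi0 (X : {set 'M[F]_6}) : X \in ovoids A H0 ->
  exists x, [/\ qf A x = 0, bf A x N != 0 & X = phi0_pt A H0 <<x>>%MS].
Proof.
rewrite inE => /existsP[W /and5P[WH /eqP rW nsW /andP[_ /forallP ind] /eqP ->]].
have [U UW tU|x [xW x0 fx]] := nondegenerate_perp_singular rW nsW.
  by apply: (implyP (ind U)); rewrite UW.
have NW : (N <= perp A W)%MS.
  by apply/perpP=> w /submx_trans/(_ WH); rewrite HN bf_sym => /eqP.
have N0 : N != 0 by apply: contraNneq fN => ->; rewrite qf0.
have NX : ~~ (N <= x)%MS by apply: contra fN => /sub_rVP[a ->]; rewrite qfZ fx mulr0.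
have EW : (perp A W <= x + N)%MS.
  by apply: sub_of_rank; rewrite ?addsmx_sub ?xW // rank_add_rV // rank_perp rW.
have WE v : (v <= W)%MS = (bf A v x == 0) && (bf A v N == 0).
  rewrite -mem_S /S -perp_perp; apply/idP/idP => /submx_trans; apply.
    by apply: perp_sub; rewrite addsmx_sub xW.
  exact: perp_sub.
exists x; split=> //.
  (* If [b(x, N)] were zero, [x] would lie in both [W] and [W^perp]. *)
  apply: contraNneq x0 => xN; rewrite -submx0 -(nonsingular_radical HF nsW) ?rW //.
  by rewrite sub_capmx xW WE alt xN eqxx.
apply: points_eq => [||v v0]; first by rewrite setIC Q0_sub_quadric.
  exact: Q0_sub_quadric.
rewrite mem_phi0 // in_setI mem_Q0 // mem_pts_of // WE (bf_sym A x).
by case: (bf A v N == 0); rewrite ?andbF ?andbT // andbC.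
Qed.

(* [p] is the only singular point of W = <x, y, N>^perp, hence lies in the
   radical of W, that is in <x, y, N>. *)
Lemma tangent_phi0 x y (p : 'rV[F]_6) :
  qf A x = 0 -> bf A x N != 0 -> qf A y = 0 -> bf A y N != 0 -> p != 0 ->
  phi0_pt A H0 <<x>>%MS :&: phi0_pt A H0 <<y>>%MS = [set <<p>>%MS] ->
  exists z : 'rV[F]_6, [/\ (z <= x + p)%MS, qf A z = 0, bf A z N != 0 &
    phi0_pt A H0 <<z>>%MS = phi0_pt A H0 <<y>>%MS].
Proof.
move=> fx xN fy yN p0 Exy.
have perpW v : (v <= perp A (x + N + y)%MS)%MS = [&& bf A v x == 0, bf A v N == 0 & bf A v y == 0].
  by rewrite perp_addsP -/(S x) mem_S perp_rVP andbA.
have memXY v : v != 0 -> qf A v = 0 -> (v <= perp A (x + N + y)%MS)%MS ->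
    <<v>>%MS \in [set <<p>>%MS].
  move=> v0 fv; rewrite perpW -Exy inE !mem_phi0 // fv eqxx (bf_sym A x) (bf_sym A y).
  by case/and3P=> -> -> ->.
have : <<p>>%MS \in [set <<p>>%MS] by rewrite inE.
rewrite -Exy inE !mem_phi0 // => /andP[/and3P[/eqP xp /eqP fp /eqP pN] /and3P[/eqP yp _ _]].
have pW : (p <= perp A (x + N + y)%MS)%MS.
  by rewrite perpW (bf_sym A p x) (bf_sym A p y) xp yp pN eqxx.
have : (p <= x + N + y)%MS.
  rewrite -perp_perp; apply/perpP=> w wW; apply/eqP/negPn/negP=> pw.
  (* [z] is the second singular point of [<w, p>] and still lies in [<x, y, N>^perp]; uniqueness
     makes it a multiple of [p], against [b(z, p) != 0]. *)
  rewrite bf_sym in pw; pose z := w - (qf A w / bf A w p) *: p.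
  have zp : bf A z p != 0 by rewrite /z -scaleNr bfDl bfZl alt mulr0 addr0.
  have z0 : z != 0 by apply: contraNneq zp => ->; rewrite bf0l.
  have /set1P/point_sub/sub_rVP[a E] : <<z>>%MS \in [set <<p>>%MS].
    by apply: memXY; rewrite ?qf_shift // addmx_sub ?eqmx_opp ?scalemx_sub.
  by case/negP: zp; rewrite E bfZl alt mulr0.
case/sub_addsmxP=> -[U1 U2] /=; set l := (U1 *m _).
have /mem_adds_rV[a [c ->]] : (l <= x + N)%MS by apply: submxMl.
rewrite [U2]mx11_scalar mul_scalar_mx; move: (U2 0 0) => b {l U1 U2} E.
(* With [b = 0], pairing with [N] gives [a = 0]; then [p] is a singular multiple of the nonsingular
   [N], so zero. *)
have b0 : b != 0.
  apply/eqP=> b0; rewrite b0 scale0r addr0 in E.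
  move: pN; rewrite E bf_lin alt mulr0 addr0 => /eqP; rewrite mulf_eq0 (negPf xN) orbF => /eqP a0.
  move: fp p0; rewrite E a0 scale0r add0r qfZ => /eqP; rewrite mulf_eq0 (negPf fN) orbF.
  by rewrite expf_eq0 => /eqP->; rewrite scale0r eqxx.
(* Solving [p = a x + c N + b y] exhibits a common vector of [<x, p>] and [<y, N>]. *)
have yE : (- b^-1 * a) *: x + b^-1 *: p = y + (b^-1 * c) *: N.
  by rewrite E; apply/rowP=> i; rewrite !mxE; field.
exists (y + (b^-1 * c) *: N); split.
- by rewrite -yE; apply/mem_adds_rV; eexists _, _.
- by rewrite -yE qf_lin fx fp xp !mulr0 !addr0.
- by rewrite bfDl bfZl alt mulr0 addr0.
- exact: phi0_translate_N.
Qed.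

(* <x, p> is an affine line of Q with affine point x and point at infinity p. *)
Definition flag x p := [&& qf A x == 0, qf A p == 0, bf A x p == 0, bf A x N != 0, bf A p N == 0 & p != 0].

(** * Affine lines of the quadrangle and their rosettes *)

Lemma rank_flag x p : flag x p -> \rank (x + p)%MS = 2%N.
Proof.
case/and5P=> _ _ _ xN /andP[/eqP pN p0]; rewrite addsmxC rank_add_rV //.
by apply: contra xN => /sub_rVP[a ->]; rewrite bfZl pN mulr0.
Qed.

Lemma tot_sing_flag x p : flag x p -> tot_sing A (x + p)%MS.
Proof. by case/and5P=> /eqP fx /eqP fp /eqP xp _ /andP[_ _]; apply: tot_sing_adds_rV. Qed.

Lemma hat_line_eq (L L' : 'M[F]_6) : (L :=: L')%MS -> hat_line H0 L = hat_line H0 L'.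
Proof. by move=> LL'; rewrite /hat_line /pts_of; congr (_ :\: _); apply/setP=> p; rewrite !inE LL'. Qed.

Lemma mem_hat_line L v : (<<v>>%MS \in hat_line H0 L) = (v <= L)%MS && (bf A v N != 0).
Proof.
have [->|v0] := eqVneq v 0; first by rewrite bf0l eqxx andbF !inE is_point_rV eqxx !andbF.
by rewrite in_setD !mem_pts_of // HN andbC.
Qed.

Lemma hat_lineP L (q : 'M[F]_6) : q \in hat_line H0 L ->
  exists v, [/\ q = <<v>>%MS, (v <= L)%MS & bf A v N != 0].
Proof.
move=> qL; have /is_pointP[v _ Eq] : is_point q by move: qL; rewrite !inE => /andP[_ /andP[]].
by exists v; move: qL; rewrite Eq mem_hat_line => /andP[].
Qed.

Lemma affine_lineP L : L \in affine_Q_lines A H0 ->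
  exists x p, flag x p /\ (L :=: x + p)%MS.
Proof.
rewrite inE => /and3P[/eqP rL tL /row_subPn[i]]; set x := row i L; rewrite HN => xN.
have xL : (x <= L)%MS by apply: row_sub.
have [p] : exists2 p : 'rV_6, (p <= L :&: perp A N)%MS & p != 0.
  apply/rowV0Pn; rewrite -mxrank_eq0 -lt0n.
  have := mxrank_sum_cap L (perp A N); have := rank_perp_ge A N; have := rank_leq_col (L + perp A N)%MS.
  by rewrite rL rank_rV; case: (N != 0) => /=; clear; lia.
rewrite sub_capmx perp_rVP => /andP[pL pN] p0.
have xp : flag x p.
  by rewrite /flag !(tot_singP _ _ tL) // (tot_sing_bf tL) // !eqxx xN pN.
exists x, p; split=> //; apply/eqmxP/andP; split; last by rewrite addsmx_sub xL.
by apply: sub_of_rank; rewrite ?addsmx_sub ?xL ?rank_flag ?rL.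
Qed.

Lemma flag_affine_line x p : flag x p -> (x + p)%MS \in affine_Q_lines A H0.
Proof.
move=> xp; rewrite inE rank_flag // tot_sing_flag // eqxx /=.
by case/and5P: xp => _ _ _ xN _; rewrite addsmx_sub HN (negPf xN).
Qed.

Lemma hatX_linesP (l : {set 'M[F]_6}) :
  reflect (exists x p, flag x p /\ l = hat_line H0 (x + p)%MS) (l \in hatX_lines A H0).
Proof.
apply: (iffP imsetP) => [[L /affine_lineP[x [p [xp Lxp]]] ->]|[x [p [xp ->]]]].
  by exists x, p; split=> //; apply: hat_line_eq.
by exists (x + p)%MS => //; apply: flag_affine_line.
Qed.

Lemma affine_line_infinity L x p : flag x p -> (L :=: x + p)%MS ->
  pts_of L :&: pts_of H0 = [set <<p>>%MS].
Proof.
case/and5P=> _ _ _ xN /andP[/eqP pN p0] Lxp; apply/setP=> q; rewrite in_setI in_set1.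
have [|Nq] := boolP (is_point q); last first.
  rewrite !inE (negPf Nq) /=; apply/esym/negbTE; apply: contra Nq => /eqP->.
  by rewrite is_point_rV.
case/is_pointP=> v v0 ->; rewrite !mem_pts_of // HN Lxp; apply/andP/eqP => [[]|/point_sub/sub_rVP[a ->]].
  case/mem_adds_rV=> a [c E]; rewrite E bf_lin pN mulr0 addr0 mulf_eq0 (negPf xN) orbF => /eqP a0.
  by rewrite -E; apply: point_eq; rewrite // E a0 scale0r add0r scalemx_sub.
by rewrite bfZl pN mulr0 eqxx scalemx_sub ?addsmxSr.
Qed.

(** Used to rebase a line at any of its affine points while keeping its point at infinity. *)
Lemma flag_move x p y : flag x p -> (y <= x + p)%MS -> bf A y N != 0 ->
  flag y p /\ (x + p :=: y + p)%MS.
Proof.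
move=> xp yL yN; have pL : (p <= x + p)%MS by apply: addsmxSr.
have yp : flag y p.
  have tL := tot_sing_flag xp; case/and5P: xp => _ fp _ _ /andP[pN p0].
  by rewrite /flag (tot_singP _ _ tL) // (tot_sing_bf tL) // eqxx fp yN pN.
split=> //; apply/eqmxP/andP; split; last by rewrite addsmx_sub yL.
by apply: sub_of_rank; rewrite ?addsmx_sub ?yL ?rank_flag.
Qed.

Lemma hatX_line_through (l : {set 'M[F]_6}) x : l \in hatX_lines A H0 -> <<x>>%MS \in l ->
  exists p, flag x p /\ l = hat_line H0 (x + p)%MS.
Proof.
case/hatX_linesP=> y [p [yp ->]]; rewrite mem_hat_line => /andP[xL xN].
by have [xp E] := flag_move yp xL xN; exists p; split=> //; apply: hat_line_eq.
Qed.

Lemma hat_line_sub x p : flag x p -> hat_line H0 (x + p)%MS \subset hatX_points A H0.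
Proof.
move=> xp; apply/subsetP=> q /hat_lineP[v [-> vL vN]]; rewrite mem_hatX vN.
by rewrite (tot_singP _ _ (tot_sing_flag xp)) ?eqxx.
Qed.

Lemma card_hat_line x p : flag x p -> #|hat_line H0 (x + p)%MS| = #|F|.
Proof.
move=> xp; have /and5P[_ _ _ xN /andP[/eqP pN p0]] := xp.
have xtN t : bf A (x + t *: p) N = bf A x N by rewrite bfDl bfZl pN mulr0 addr0.
have -> : hat_line H0 (x + p)%MS = [set <<x + t *: p>>%MS | t : F].
  apply/setP=> q; apply/idP/imsetP => [/hat_lineP[v [-> + vN]]|[t _ ->]].
    case/mem_adds_rV=> a [c E]; have a0 : a != 0.
      by apply: contraNneq vN => a0; rewrite E bf_lin a0 pN mul0r mulr0 addr0.
    exists (c / a) => //; apply: point_eq; first exact: nonzero_of_affine.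
    by apply/sub_rVP; exists a; rewrite E scalerDr scalerA (mulrC a) divfK.
  by rewrite mem_hat_line xtN xN andbT -[x in (x + _)%R]scale1r; apply/mem_adds_rV; exists 1, t.
(* All vectors [x + t p] have the same nonzero product with [N], so proportional ones are equal. *)
rewrite card_imset // => t s /point_sub/sub_rVP[a E].
have a1 : a = 1.
  have := xtN t; rewrite E bfZl xtN -[RHS]mul1r; exact: mulIf.
move: E; rewrite a1 scale1r => /addrI/eqP; rewrite -subr_eq0 -scalerBl scaler_eq0 (negPf p0) orbF.
by rewrite subr_eq0 => /eqP.
Qed.

(** Equal images give [w = a v + b N]; then [b N] lies on a totally singular line, and [f(N) != 0]
    forces [b = 0]. *)
Lemma phi0_inj_hat_line x p : flag x p ->
  {in hat_line H0 (x + p)%MS &, injective (phi0_pt A H0)}.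
Proof.
move=> xp _ _ /hat_lineP[v [-> vL vN]] /hat_lineP[w [-> wL wN]] /(phi0_inj vN)/mem_adds_rV[a [b E]].
have tL := tot_sing_flag xp.
have b0 : b = 0.
  have : (b *: N <= x + p)%MS.
    have -> : b *: N = w - a *: v by rewrite E addrAC subrr add0r.
    by rewrite addmx_sub ?eqmx_opp ?scalemx_sub.
  move/(tot_singP _ _ tL)/eqP; rewrite qfZ mulf_eq0 (negPf fN) orbF expf_eq0.
  by move/eqP.
apply/esym/point_eq; first exact: nonzero_of_affine wN.
by rewrite E b0 scale0r addr0 scalemx_sub.
Qed.

(** A generalized quadrangle has no triangles: a singular [z] orthogonal to [v] and [w] is
    orthogonal to their line, hence lies on it by maximality, and [p] is its only point in [H_0]. *)
Lemma phi0_meet x p v w : flag x p -> (v <= x + p)%MS -> (w <= x + p)%MS ->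
  bf A v N != 0 -> bf A w N != 0 -> <<v>>%MS != <<w>>%MS :> 'M_6 ->
  phi0_pt A H0 <<v>>%MS :&: phi0_pt A H0 <<w>>%MS = [set <<p>>%MS].
Proof.
move=> xp vL wL vN wN vw; have tL := tot_sing_flag xp; have rL := rank_flag xp.
have /and5P[_ /eqP fp _ xN /andP[/eqP pN p0]] := xp.
have v0 := nonzero_of_affine vN; have w0 := nonzero_of_affine wN.
have Lvw : (x + p <= v + w)%MS.
  apply: sub_of_rank; first by rewrite addsmx_sub vL.
  rewrite rL rank_add_rV //; apply: contra vw => wv.
  by rewrite (point_eq w0 wv).
apply: points_eq => [||z z0].
- by rewrite subIset // Q0_sub_quadric.
- by rewrite sub1set mem_quadric // fp.
rewrite in_setI in_set1 !mem_phi0 //; apply/andP/eqP => [[/and3P[/eqP vz /eqP fz zN] /and3P[/eqP wz _ _]]|].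
  have /mem_adds_rV[a [c E]] : (z <= x + p)%MS.
    apply: tot_sing_max => // u /submx_trans/(_ Lvw)/mem_adds_rV[a [c ->]].
    by rewrite bf_lin vz wz !mulr0 addr0.
  apply: point_eq => //; move: zN; rewrite E bf_lin pN mulr0 addr0 mulf_eq0 (negPf xN) orbF.
  by move/eqP->; rewrite scale0r add0r scalemx_sub.
move/point_sub/sub_rVP=> [a ->].
rewrite qfZ !bfZr bfZl fp pN !(tot_sing_bf tL _ (addsmxSr _ _)) // !mulr0 eqxx.
by [].
Qed.

Lemma rosette_hat_line x p : flag x p ->
  rosette_at A H0 <<p>>%MS (phi0_line A H0 (hat_line H0 (x + p)%MS)).
Proof.
move=> xp; have /and5P[_ fp _ _ /andP[pN p0]] := xp; apply/and4P; split.
- by rewrite mem_Q0 // fp.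
- by rewrite card_in_imset ?card_hat_line //; apply: phi0_inj_hat_line.
- apply/subsetP=> _ /imsetP[q /(subsetP (hat_line_sub xp)) qX ->].
  by have [v [-> fv vN]] := hatX_pointsP qX; apply: phi0_ovoid.
apply/forall_inP=> _ /imsetP[_ /hat_lineP[v [-> vL vN]] ->].
apply/forall_inP=> _ /imsetP[_ /hat_lineP[w [-> wL wN]] ->].
apply/implyP=> vw; apply/eqP; apply: (phi0_meet xp) => //.
by apply: contraNneq vw => ->.
Qed.

(** * Rosettes through a given ovoid *)

(** Since [q > 1] there is a second ovoid, which makes the pairwise condition effective and recovers
    [p] as an intersection. *)
Lemma rosette_other p (R : {set {set 'M[F]_6}}) X : rosette_at A H0 p R -> X \in R ->
  exists Y, [/\ Y \in R, X != Y & X :&: Y = [set p]].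
Proof.
case/and4P=> _ /eqP cR _ /forall_inP meet XR.
have : (1 < #|F|)%N by apply: finNzRing_gt1.
rewrite -cR (cardsD1 X R) XR => /card_gt0P[Y].
rewrite !inE => /andP[YX YR].
exists Y; split; rewrite // 1?eq_sym //.
by apply/eqP/(implyP (forall_inP (meet X XR) Y YR)); rewrite eq_sym.
Qed.

Lemma rosette_base_uniq p p' (R : {set {set 'M[F]_6}}) :
  rosette_at A H0 p R -> rosette_at A H0 p' R -> p = p'.
Proof.
move=> Rp Rp'; have /and4P[_ /eqP cR _ _] := Rp.
have /card_gt0P[X XR] : (0 < #|R|)%N by rewrite cR ltnW // finNzRing_gt1.
have [Y [YR XY EXY]] := rosette_other Rp XR.
have /and4P[_ _ _ /forall_inP/(_ X XR)/forall_inP/(_ Y YR)] := Rp'.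
by rewrite XY EXY /= => /eqP/set1_inj.
Qed.

(** Every other ovoid of [R] is tangent at [p] to that of [x], so it comes from an affine point of
    [<x, p>]. Thus [R] is contained in a set with the same number [q] of elements. *)
Lemma rosette_phi0 x p (R : {set {set 'M[F]_6}}) : qf A x = 0 -> bf A x N != 0 ->
  rosette_at A H0 p R -> phi0_pt A H0 <<x>>%MS \in R ->
  exists p', flag x p' /\ R = phi0_line A H0 (hat_line H0 (x + p')%MS).
Proof.
move=> fx xN Rp xR; have [Y [YR _ EY]] := rosette_other Rp xR.
have /and4P[pQ /eqP cR /subsetP Rov /forall_inP/(_ _ xR)/forall_inP meet] := Rp.
have /is_pointP[q q0 Ep] : is_point p by move: pQ; rewrite !inE => /andP[/andP[]].
have : p \in phi0_pt A H0 <<x>>%MS by have /setIP[] : p \in phi0_pt A H0 <<x>>%MS :&: Y by rewrite EY inE.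
rewrite Ep mem_phi0 // => /and3P[xq fq qN].
have xq_flag : flag x q by rewrite /flag fx eqxx fq xq xN qN.
exists q; split=> //; apply/eqP; rewrite eqEcard cR card_in_imset; last exact: phi0_inj_hat_line.
rewrite card_hat_line // leqnn andbT; apply/subsetP=> Z ZR.
have [<-|xZ] := eqVneq (phi0_pt A H0 <<x>>%MS) Z.
  by apply: imset_f; rewrite mem_hat_line addsmxSl.
have /eqP := implyP (meet Z ZR) xZ; have [y [fy yN ->]] := ovoid_phi0 (Rov Z ZR).
rewrite Ep => /(tangent_phi0 fx xN fy yN q0)[z [zL fz zN <-]].
by apply: imset_f; rewrite mem_hat_line zL.
Qed.

(** * Fibres and the covering property *)

Lemma card_phi0_fiber (X : {set 'M[F]_6}) : X \in ovoids A H0 ->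
  #|[set x in hatX_points A H0 | phi0_pt A H0 x == X]| = 2%N.
Proof.
(* [c] is the nonzero root of [f(x + a N) = a b(x, N) + a^2 f(N)] as a polynomial in [a]. *)
case/ovoid_phi0=> x [fx xN ->]; pose c := - (bf A x N / qf A N).
have c0 : c != 0 by rewrite oppr_eq0 mulf_neq0 ?invr_eq0.
have fc a : (qf A (x + a *: N) == 0) = (a == 0) || (a == c).
  have -> : qf A (x + a *: N) = a * (a - c) * qf A N.
    by rewrite -[x in (x + _)%R]scale1r qf_lin fx /c; field.
  by rewrite !mulf_eq0 (negPf fN) orbF subr_eq0.
have xcN a : bf A (x + a *: N) N = bf A x N by rewrite bfDl bfZl alt mulr0 addr0.
suff -> : [set y in hatX_points A H0 | phi0_pt A H0 y == phi0_pt A H0 <<x>>%MS] =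
          [set <<x>>%MS; <<x + c *: N>>%MS].
  rewrite cards2; case: eqP => // /esym/point_sub/sub_rVP[a E].
  have a1 : a = 1 by have := xcN c; rewrite E bfZl -[RHS]mul1r; apply: mulIf.
  move/eqP: E; rewrite a1 scale1r -[X in _ == X]addr0 (inj_eq (addrI _)) scaler_eq0 (negPf c0) /=.
  by move=> /eqP N0; have := fN; rewrite N0 qf0 eqxx.
apply/setP=> q; rewrite [LHS]inE in_set2; apply/andP/orP => [[/hatX_pointsP[y [-> fy yN]] /eqP/esym]|].
  move/(phi0_inj xN)/mem_adds_rV=> [a [b E]].
  have a0 : a != 0.
    by apply: contraNneq yN => a0; rewrite E bf_lin a0 mul0r alt mulr0 addr0.
  have Ey : y = a *: (x + (b / a) *: N) by rewrite E scalerDr scalerA (mulrC a) divfK.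
  have -> : <<y>>%MS = <<x + (b / a) *: N>>%MS :> 'M_6.
    by apply: point_eq; [exact: nonzero_of_affine|rewrite Ey scalemx_sub].
  move/eqP: fy; rewrite Ey qfZ mulf_eq0 expf_eq0 (negPf a0) /= fc => /orP[] /eqP->.
    by left; rewrite scale0r addr0.
  by right.
case=> /eqP->; first by rewrite mem_hatX fx xN !eqxx.
by rewrite mem_hatX phi0_translate_N xcN xN fc !eqxx orbT.
Qed.

Lemma phi0_covering : geom_covering (hatX_points A H0) (hatX_lines A H0) (ovoids A H0)
  (rosettes A H0) (phi0_pt A H0) (phi0_line A H0).
Proof.
have line_sub l : l \in hatX_lines A H0 -> [set x in hatX_points A H0 | x \in l] = l.
  move=> /hatX_linesP[x [p [xp ->]]]; apply/setP=> q; rewrite inE.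
  by apply: andb_idl; apply/subsetP/hat_line_sub.
have line_ros l : l \in hatX_lines A H0 -> phi0_line A H0 l \in rosettes A H0.
  move=> /hatX_linesP[x [p [xp ->]]]; rewrite inE; apply/existsP.
  by exists <<p>>%MS; apply: rosette_hat_line.
have pt_ov : {in hatX_points A H0, forall q : 'M_6, phi0_pt A H0 q \in ovoids A H0}.
  by move=> q /hatX_pointsP[x [-> fx xN]]; apply: phi0_ovoid.
split=> // [x l _ _ xl|l lX|q /hatX_pointsP[x [-> fx xN]]].
- exact: imset_f.
- rewrite line_sub //; split.
    by have [x [p [xp ->]]] := hatX_linesP _ lX; apply: phi0_inj_hat_line.
  apply/setP=> Y; rewrite inE; apply/esym/andb_idl=> /imsetP[q ql ->].
  by apply: pt_ov; move: ql; rewrite -(line_sub l) // inE => /andP[].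
split=> [l m|].
  (* Lines through [x] with the same image share the base point of that rosette; it is their point
     at infinity, so they coincide. *)
  rewrite !inE => /andP[/hatX_line_through lX /lX[p [xp ->]]].
  move=> /andP[/hatX_line_through mX /mX[p' [xp' ->]]] E.
  have := rosette_hat_line xp'; rewrite -E => /(rosette_base_uniq (rosette_hat_line xp))/genmxP/eqmxP pp'.
  exact: hat_line_eq (adds_eqmx (eqmx_refl _) pp').
apply/setP=> R; rewrite !inE; apply/imsetP/andP => [[l]|[/existsP[p Rp] xR]].
  by rewrite inE => /andP[lX xl] ->; split; [have := line_ros l lX; rewrite inE|exact: imset_f].
have [p' [xp' ->]] := rosette_phi0 fx xN Rp xR.
exists (hat_line H0 (x + p')%MS) => //; rewrite inE mem_hat_line addsmxSl xN !andbT.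
by apply/hatX_linesP; exists x, p'.
Qed.

End EllipticQuadric.

(** Fix a point [y] on [m]. Each point over [y] lies on exactly one line over [m], and each line
    over [m] contains exactly one point over [y], so the two fibres have the same size. *)
Lemma covering_two_fold (P P' : finType) (pts : {set P}) (lns : {set {set P}})
    (pts' : {set P'}) (lns' : {set {set P'}}) (f : P -> P') (g : {set P} -> {set P'}) :
  geom_covering pts lns pts' lns' f g ->
  {in lns', forall m : {set P'}, exists2 y, y \in pts' & y \in m} ->
  (forall y, y \in pts' -> #|[set x in pts | f x == y]| = 2%N) ->
  two_fold pts lns pts' lns' f g.
Proof.
case=> fP gP _ cl cp ne fib; split=> // m mX; have [y yX ym] := ne m mX.
have /cards2P[x1 [x2 [x12 E]]] : #|[set x in pts | f x == y]| == 2%N by rewrite fib.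
have inf x : (x \in pts) && (f x == y) = (x == x1) || (x == x2).
  by move/setP/(_ x): E; rewrite !inE.
have /andP[x1P /eqP f1] : (x1 \in pts) && (f x1 == y) by rewrite inf eqxx.
have /andP[x2P /eqP f2] : (x2 \in pts) && (f x2 == y) by rewrite inf eqxx orbT.
have lift x : x \in pts -> f x = y -> exists l, [/\ l \in lns, x \in l & g l = m].
  move=> xP fx; have [_ /setP/(_ m)] := cp x xP; rewrite [in RHS]inE mX fx ym.
  by case/imsetP=> l; rewrite inE => /andP[lL xl] ->; exists l.
have [l1 [l1L xl1 g1]] := lift x1 x1P f1; have [l2 [l2L xl2 g2]] := lift x2 x2P f2.
have l12 : l1 != l2.
  apply: contraNneq x12 => l12; have [inj _] := cl l1 l1L.
  by apply/eqP/inj; rewrite ?inE ?x1P ?x2P ?xl1 ?f1 // l12.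
suff -> : [set l in lns | g l == m] = [set l1; l2] by rewrite cards2 l12.
have uniq x l l' : x \in pts -> l \in lns -> l' \in lns -> x \in l -> x \in l' ->
    g l = g l' -> l = l'.
  by move=> xP lL l'L xl xl'; have [inj _] := cp x xP; apply: inj; rewrite inE ?lL ?l'L.
apply/setP=> l; rewrite !inE; apply/andP/orP => [[lL /eqP gl]|[]/eqP->]; last 2 first.
- by rewrite l1L g1.
- by rewrite l2L g2.
(* The points of [l] map onto those of [m], so [l] passes through [x1] or [x2]. *)
have [_ /setP/(_ y)] := cl l lL; rewrite [in RHS]inE yX gl ym => /imsetP[x].
rewrite inE => /andP[xP xl] yE; have : (x \in pts) && (f x == y) by rewrite xP yE eqxx.
rewrite inf => /orP[]/eqP Ex; rewrite Ex in xl; [left|right]; apply/eqP.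
  by apply: (uniq x1) => //; rewrite gl g1.
by apply: (uniq x2) => //; rewrite gl g2.
Qed.

Theorem theorem1 (F : finFieldType) (n : nat) (HF : #|F| = (2 ^ n)%N)
    (A : 'M[F]_6)
    (HQ : nonsingular_on A 1%:M && witt_index_on A 1%:M 2)
    (H0 : 'M[F]_6) (HH0 : \rank H0 = 5%N)
    (HQ0 : nonsingular_on A H0 && witt_index_on A H0 2) :
  (* well defined on points *)
  {in hatX_points A H0, forall x, phi0_pt A H0 x \in ovoids A H0} /\
  (* well defined on lines: phi0(hat l) is a rosette based at l^infty *)
  (forall L, L \in affine_Q_lines A H0 ->
     exists2 p, pts_of L :&: pts_of H0 = [set p] &
                rosette_at A H0 p (phi0_line A H0 (hat_line H0 L))) /\
  (* phi0 is a 2-fold covering from hat X to X *)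
  geom_covering (hatX_points A H0) (hatX_lines A H0) (ovoids A H0) (rosettes A H0)
                (phi0_pt A H0) (phi0_line A H0) /\
  two_fold (hatX_points A H0) (hatX_lines A H0) (ovoids A H0) (rosettes A H0)
           (phi0_pt A H0) (phi0_line A H0).
Proof.
have [nsH0 _] := andP HQ0; have [N [fN HN]] := perp_nucleus HF HQ HH0 nsH0.
have cov := phi0_covering HF HQ fN HN; split; first by case: cov.
split=> [L LX|].
  have [x [p [xp Lxp]]] := affine_lineP HN LX; exists <<p>>%MS.
    exact: (affine_line_infinity HN xp Lxp).
  by rewrite (hat_line_eq _ Lxp); apply: (rosette_hat_line HF HQ fN HN xp).
split=> //; apply: covering_two_fold => // [R|X XO].
  rewrite inE => /existsP[p /and4P[_ /eqP cR /subsetP Rov _]].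
  have /card_gt0P[X XR] : (0 < #|R|)%N by rewrite cR ltnW // finNzRing_gt1.
  by exists X; rewrite ?Rov.
exact: (card_phi0_fiber HF HQ fN HN XO).
Qed.
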